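(* Let $\pi$ be a Borel probability measure on $\mathcal{X}$ and $(\mathcal{P}_\gamma)_{\gamma\in\mathcal{Y}}$ a family of Borel Markov kernels on $\mathcal{X}$ as in the context. Assume there is a Borel function $W:\mathcal{X}\to[1,\infty)$ and constants $C\in(0,1]$ and $\kappa\in(0,\infty)$ such that $$\pi(\{x: W(x)\ge r\})\ge C r^{-\kappa}\quad\text{for all } r\ge 1,$$ and there are $\alpha>\kappa$ and a concave function $\phi:(0,\infty)\to(0,\infty)$ such that $$\int_{\mathcal{X}}W(y)^\alpha\,\mathcal{P}_\gamma(x,dy)-W(x)^\alpha\le\phi(W(x)^\alpha)\quad\text{for all }(x,\gamma)\in\mathcal{X}\times\mathcal{Y}.$$ Let $$M=C^{\frac{\alpha}{\alpha-\kappa}}\left[(\kappa/\alpha)^{\frac{\kappa}{\alpha-\kappa}}-(\kappa/\alpha)^{\frac{\alpha}{\alpha-\kappa}}\right].$$ Assume also that $\log(W)$ is Lipschitz continuous (with respect to the metric $d$). Then for any $\epsilon\in(0,1)$ there is $\delta_\epsilon\in(0,1)$ such that for all $t\in\mathbb{Z}_+$, $$\inf_{\mathcal{Q}\in\mathcal{S}(\mathcal{X},\mathcal{Y})}\ \inf_{\xi\in\mathcal{C}\left[\mathcal{A}_{\mathcal{Q}}^{(t)}((\gamma_0,x_0),\cdot),\,\pi\right]}\xi\left(\{(x,y)\in\mathcal{X}\times\mathcal{X}:d(x,y)>\delta_\epsilon\}\right)\ge\frac{(1-\epsilon)M}{\left(H^{-1}_{W(x_0)^\alpha,\phi}(t)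\right)^{\frac{\kappa}{\alpha-\kappa}}}.$$
   Context: $(\mathcal{X},d)$ is a Polish space with metric $d$ (state space) and $\mathcal{Y}$ is a Borel measurable space (tuning parameters), with Borel sigma-algebras $\mathcal{B}(\mathcal{X}),\mathcal{B}(\mathcal{Y})$. $\mathbb{Z}_+$ denotes the positive integers. $(\mathcal{P}_\gamma)_{\gamma\in\mathcal{Y}}$ is a family of Markov kernels $\mathcal{P}_\gamma:\mathcal{X}\times\mathcal{B}(\mathcal{X})\to[0,1]$ such that $(x,\gamma)\mapsto\mathcal{P}_\gamma(x,\cdot)$ is Borel measurable. Adaptive process: an adaptation plan $\mathcal{Q}$ is a sequence $(\mathcal{Q}_t)_{t\in\mathbb{Z}_+}$ of Borel probability kernels $\mathcal{Q}_t:(\mathcal{Y}\times\mathcal{X})^t\times\mathcal{B}(\mathcal{Y})\to[0,1]$; $\mathcal{S}(\mathcal{X},\mathcal{Y})$ is the set of all adaptation plans. Given $\mathcal{Q}$ and a fixed initialization $(\Gamma_0,X_0)=(\gamma_0,x_0)\in\mathcal{Y}\times\mathcal{X}$, the adaptive process $(\Gamma_t,X_t)_{t\ge0}$ is defined for $t\ge1$ by $\Gamma_t\mid(\Gamma_s,X_s)_{0\le s\le t-1}\sim\mathcal{Q}_t((\Gamma_s,X_s)_{0\le s\le t-1},\cdot)$ and then, conditionally on $\Gamma_t$ and the past, $X_t\sim\mathcal{P}_{\Gamma_t}(X_{t-1},\cdot)$. The marginal law of $X_t$ is denoted $\mathcal{A}_{\mathcal{Q}}^{(t)}((\gamma_0,x_0),\cdot)$.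 $\mathcal{C}(\mu,\nu)$ (also written $\mathcal{C}[\mu,\nu]$) is the set of couplings of $\mu$ and $\nu$ (Borel probability measures on $\mathcal{X}\times\mathcal{X}$ with marginals $\mu,\nu$). For concave $\phi:(0,\infty)\to(0,\infty)$ and $w_0\in[1,\infty)$, define $H_{w_0,\phi}(w)=\int_{w_0}^w\frac{dv}{\phi(v)}$ for $w\ge w_0$; this is a strictly increasing function from $[w_0,\infty)$ onto $[0,\infty)$ and $H^{-1}_{w_0,\phi}:[0,\infty)\to[w_0,\infty)$ denotes its inverse. *)

(* Defs.v *)
From HB Require Import structures.
From mathcomp Require Import all_boot all_order all_algebra.
From mathcomp Require Import all_classical all_reals all_analysis.
From mathcomp Require Import measurable_realfun.

Set Implicit Arguments.
Unset Strict Implicit.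
Unset Printing Implicit Defensive.
Import Order.TTheory GRing.Theory Num.Theory.
Import numFieldNormedType.Exports.

Local Open Scope classical_set_scope.
Local Open Scope ring_scope.

HB.mixin Record isSeparable T & Topological T := {
  separable_space : exists2 D : set T, countable D & dense D
}.

#[short(type="polishMetricType")]
HB.structure Definition PolishMetric (R : numDomainType) :=
  { T of Complete T & Metric R T & isSeparable T }.

Notation borel X := (g_sigma_algebraType (@open X)).

Section composition_of_probability_kernels.
Context {d0 d1 d2} {T0 : measurableType d0} {T1 : measurableType d1}
  {T2 : measurableType d2} {R : realType}.
Local Open Scope ereal_scope.

(* `mkcomp_noparam` is only declared as a subprobability kernel and `mkcomp`
   as an s-finite kernel. *)
Section noparam.
Variables (k1 : R.-pker T0 ~> T1) (k2 : R.-pker T1 ~> T2).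

Definition pkcomp : T0 -> {measure set T2 -> \bar R} := mkcomp_noparam k1 k2.

Let measurable_pkcomp U : measurable U -> measurable_fun [set: T0] (fun x => pkcomp x U).
Proof. exact: (measurable_kernel (mkcomp_noparam k1 k2)). Qed.

HB.instance Definition _ := isKernel.Build _ _ _ _ _ pkcomp measurable_pkcomp.

Let pkcomp_setT x : pkcomp x setT = 1.
Proof.
rewrite /pkcomp /= /kcomp_noparam.
under eq_integral do rewrite prob_kernel.
by rewrite integral_cst// mul1e prob_kernel.
Qed.

HB.instance Definition _ :=
  Kernel_isProbability.Build _ _ _ _ _ pkcomp pkcomp_setT.
End noparam.

Section param.
Variables (k1 : R.-pker T0 ~> T1) (k2 : R.-pker (T0 * T1) ~> T2).

Definition pkcomp_param : T0 -> {measure set T2 -> \bar R} := mkcomp k1 k2.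

Let measurable_pkcomp_param U :
  measurable U -> measurable_fun [set: T0] (fun x => pkcomp_param x U).
Proof. exact: measurable_fun_mkcomp_sfinite. Qed.

HB.instance Definition _ :=
  isKernel.Build _ _ _ _ _ pkcomp_param measurable_pkcomp_param.

Let pkcomp_param_setT x : pkcomp_param x setT = 1.
Proof.
rewrite /pkcomp_param /= /kcomp.
under eq_integral do rewrite prob_kernel.
by rewrite integral_cst// mul1e prob_kernel.
Qed.

HB.instance Definition _ :=
  Kernel_isProbability.Build _ _ _ _ _ pkcomp_param pkcomp_param_setT.
End param.

Section precomposition.
Variables (k : R.-pker T1 ~> T2) (f : T0 -> T1).

Definition kprecomp (mf : measurable_fun [set: T0] f) (x : T0) :
  {measure set T2 -> \bar R} := k (f x).

Hypothesis mf : measurable_fun [set: T0] f.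

Let measurable_kprecomp U :
  measurable U -> measurable_fun [set: T0] (fun x => kprecomp mf x U).
Proof.
move=> mU; apply: (measurableT_comp (measurable_kernel k U mU)); exact: mf.
Qed.

HB.instance Definition _ :=
  isKernel.Build _ _ _ _ _ (kprecomp mf) measurable_kprecomp.

Let kprecomp_setT x : kprecomp mf x setT = 1.
Proof. exact: prob_kernel. Qed.

HB.instance Definition _ :=
  Kernel_isProbability.Build _ _ _ _ _ (kprecomp mf) kprecomp_setT.
End precomposition.
End composition_of_probability_kernels.

Section adaptive_process.
Context {R : realType} {dX dY : measure_display}
  {X : measurableType dX} {Y : measurableType dY}.

(* (Gamma_s, X_s) for 0 <= s <= t *)
Local Notation history t := (t.+1.-tuple (Y * X)%type).

Definition current_state t (h : history t) : X := (tnth h ord_max).2.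

Definition extend t (u : (history t * Y) * X) : history t.+1 :=
  [tuple of rcons u.1.1 (u.1.2, u.2)].

Definition initial_history (z : Y * X) : history 0 := [tuple z].

Lemma measurable_current_state t :
  measurable_fun [set: history t] (@current_state t).
Proof.
exact: (measurableT_comp measurable_snd
  (@measurable_tnth _ (Y * X)%type _ ord_max)).
Qed.

Lemma measurable_extend t : measurable_fun setT (@extend t).
Proof.
apply/measurable_fun_tnthP => i /=.
have [it|ti] := ltnP i t.+1.
- rewrite (_ : _ \o _ = fun u => tnth u.1.1 (Ordinal it)); last first.
    apply/funext => u /=.
    have z0 : Y * X := (u.1.2, u.2).
    by rewrite !(tnth_nth z0) /= nth_rcons size_tuple it.
  apply: (measurableT_comp (@measurable_tnth _ (Y * X)%type _ (Ordinal it))).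
  exact: (measurableT_comp measurable_fst measurable_fst).
- rewrite (_ : _ \o _ = fun u => (u.1.2, u.2)); last first.
    apply/funext => u /=.
    rewrite (tnth_nth (u.1.2, u.2)) /= nth_rcons size_tuple ltnNge ti /=.
    have -> : nat_of_ord i = t.+1 by apply/eqP; rewrite eqn_leq ti -ltnS ltn_ord.
    by rewrite eqxx.
  apply: measurable_fun_pair => //.
  exact: (measurableT_comp measurable_snd measurable_fst).
Qed.

Lemma measurable_initial_history : measurable_fun setT initial_history.
Proof.
apply/measurable_fun_tnthP => i /=.
rewrite (_ : _ \o _ = id); last by apply/funext => z /=; rewrite ord1.
exact: measurable_id.
Qed.

(* `Q t` is the kernel from (Gamma_s, X_s)_(0 <= s <= t) to the law of
   Gamma_(t+1). *)
Definition adaptation_plan := forall t : nat, R.-pker history t ~> Y.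

Variable P : R.-pker (X * Y) ~> X.

Lemma measurable_state_parameter t :
  measurable_fun setT (fun u : history t * Y => (current_state u.1, u.2)).
Proof.
apply: measurable_fun_pair => //.
exact: (measurableT_comp (@measurable_current_state t) measurable_fst).
Qed.

Definition adaptive_step (Q : adaptation_plan) t :
    R.-pker history t ~> history t.+1 :=
  pkcomp_param (Q t)
    (pkcomp_param (kprecomp P (@measurable_state_parameter t))
      (kdirac (@measurable_extend t))).

Fixpoint history_law (Q : adaptation_plan) t : R.-pker (Y * X) ~> history t :=
  match t with
  | 0 => kdirac measurable_initial_history
  | t'.+1 => pkcomp (history_law Q t') (adaptive_step Q t')
  end.

Definition state_law (Q : adaptation_plan) t : R.-pker (Y * X) ~> X :=
  pkcomp (history_law Q t) (kdirac (@measurable_current_state t)).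

Local Open Scope ereal_scope.

Lemma history_law0 Q z : history_law Q 0 z = \d_(initial_history z).
Proof. by []. Qed.

Lemma history_lawS Q t z A : measurable A ->
  history_law Q t.+1 z A =
  \int[history_law Q t z]_h \int[Q t h]_g
    P (current_state h, g) [set x | A (extend (h, g, x))].
Proof.
move=> mA; rewrite /= /pkcomp /= /kcomp_noparam.
apply: eq_integral => h _; rewrite /pkcomp_param /= /kcomp.
apply: eq_integral => g _; rewrite /pkcomp_param /= /kcomp /kprecomp /=.
rewrite -[X in P _ X]setIT -integral_indic//.
have mf : measurable_fun [set: X] (fun x => extend (h, g, x)).
  apply: (measurableT_comp (@measurable_extend t)).
  exact: measurable_fun_pair.
by rewrite -[X in measurable X]setTI; exact: mf.
Qed.

Lemma state_lawE Q t z B : measurable B ->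
  state_law Q t z B = history_law Q t z (@current_state t @^-1` B).
Proof.
move=> mB; rewrite /= /pkcomp /= /kcomp_noparam.
rewrite -[X in history_law Q t z X]setIT -integral_indic//.
by rewrite -[X in measurable X]setTI; exact: measurable_current_state.
Qed.

End adaptive_process.
Arguments adaptation_plan R {dX dY} X Y.

Definition coupling {R : realType} {d1 d2 : measure_display}
    {T1 : measurableType d1} {T2 : measurableType d2}
    (mu : {measure set T1 -> \bar R}) (nu : {measure set T2 -> \bar R}) :
    set (probability (T1 * T2)%type R) :=
  [set xi | (forall A, measurable A -> xi (A `*` setT) = mu A) /\
            (forall B, measurable B -> xi (setT `*` B) = nu B)].

Definition concave_function {R : realType} (D : set R) (f : R -> R) :=
  convex_function (D : set R^o) (\- f : R^o -> R^o).

Definition lipschitz_fun {R : realType} {X : metricType R} (f : X -> R) :=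
  exists L : R, forall x y, `|f x - f y| <= L * mdist x y.

Section comparison_function.
Context {R : realType}.
Variables (w0 : R) (phi : R -> R).

Definition Hfun (w : R) : R :=
  \int[lebesgue_measure]_(v in `[w0, w]) (phi v)^-1.

(* The default value w0 only matters outside of the image of `Hfun`, which is
   `[0, +oo[ when phi is positive and concave on `]0, +oo[ and w0 >= 1. *)
Definition Hinv : R -> R := 'pinv_(fun=> w0) `[w0, +oo[ Hfun.

End comparison_function.

(* Main.v *)
Require Import Defs.
From HB Require Import structures.
From mathcomp Require Import all_boot all_order all_algebra.
From mathcomp Require Import all_classical all_reals all_analysis.
From mathcomp Require Import measurable_realfun.
From mathcomp Require Import ring lra.

Set Implicit Arguments.
Unset Strict Implicit.
Unset Printing Implicit Defensive.
Import Order.TTheory GRing.Theory Num.Theory.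
Import numFieldNormedType.Exports.

Local Open Scope classical_set_scope.
Local Open Scope ring_scope.

(** Two facts are in tension. The law [pi] has a heavy tail,
[pi (W >= r) >= C r^-kappa], whereas the drift condition lets the moment of
order [alpha > kappa] of [W (X_t)] grow only at a rate set by [phi],
whatever the adaptation plan; by Markov's inequality the tail of [W (X_t)]
is then lighter than that of [pi] at high levels.

Moments. Each parameter satisfies the same drift inequality, so averaging over
the choice of the parameter preserves it. Bounding the concave function [phi]
by an affine support line at [b_t] turns the pointwise drift into the recursion
[E W(X_t)^alpha <= b_t], where [b_0 = W(x0)^alpha] and
[b_(t+1) = b_t + phi b_t] ([state_law_drift]). A positive concave function
on the half-line is nondecreasing, hence each step of this recursion increases
[Hfun] by at most 1, which gives [b_t <= Hinv t] ([euler_scheme_le_Hinv]).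

Couplings. If [d(x, y) <= delta], the Lipschitz property of [ln W] gives
[W y <= exp(L delta) W x]. So under any coupling the event [W y >= r] is
contained in [d(x, y) > delta] or [W x >= r exp(- L delta)]
([coupling_tail_le]), and for every [r >= 1]
[[
  C r^-kappa <= xi (d > delta) + Hinv(t) exp(alpha L delta) r^-alpha.
]]
Maximising [C r^-kappa - A r^-alpha] over [r] produces the constant [M] and the
power of [Hinv(t)] ([tail_difference_max]); the maximiser is at least 1
because [C <= 1 <= A] and [kappa < alpha]. The factor [exp(alpha L delta)] does not depend on [t],
and it costs at most a factor [1 - eps] once [delta] is small. *)

(** * Concave functions on the positive half-line *)

Section concave.
Context {R : realType}.
Variable phi : R -> R.
Hypothesis phi_gt0 : forall v : R, 0 < v -> 0 < phi v.
Hypothesis phi_concave : concave_function `]0, +oo[ phi.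

(** Concavity at [b = l * u + (1 - l) * v], with [l = (v - b) / (v - u)], cleared of
denominators. *)
Lemma concave_three_points (u b v : R) : 0 < u -> u < b -> b < v ->
  (v - b) * phi u + (b - u) * phi v <= (v - u) * phi b.
Proof.
move=> u0 ub bv.
have vu : 0 < v - u by lra.
have t01 : Itv.spec (@Itv.num_sem R) (Itv.Real `[0%Z, 1%Z]) ((v - b) / (v - u)).
  rewrite /Itv.num_sem /= num_real/= in_itv/= divr_ge0//=; [|lra|lra].
  rewrite ler_pdivrMr//; lra.
pose t := Itv.mk t01.
have uP : (u : R^o) \in (`]0, +oo[%classic : set R).
  by rewrite inE/= in_itv/= u0.
have vP : (v : R^o) \in (`]0, +oo[%classic : set R).
  by rewrite inE/= in_itv/= andbT; lra.
pose l := (v - b) / (v - u).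
have : - phi (l * u + (1 - l) * v) <= l * - phi u + (1 - l) * - phi v.
  have h := phi_concave t uP vP.
  by rewrite /= /conv/= /unstable.onem/= in h; exact: h.
have -> : l * u + (1 - l) * v = b by rewrite /l; field; lra.
rewrite /l.
have -> : (v - b) / (v - u) * - phi u + (1 - (v - b) / (v - u)) * - phi v =
   - (((v - b) * phi u + (b - u) * phi v) / (v - u)).
  by field; lra.
by rewrite lerN2 ler_pdivrMr// [X in _ <= X]mulrC.
Qed.

(** The slope [c] is the supremum of the slopes of chords to the right of [b],
which every chord to the left of [b] bounds from above. The sign of [c] and the
bound [c * b <= phi b] come from positivity: an affine function that is positive
on the half-line can neither decrease nor start below zero. *)
Lemma concave_support_line (b : R) : 0 < b -> exists c : R,
  [/\ 0 <= c, c * b <= phi b & forall v : R, 0 < v -> phi v <= phi b + c * (v - b)].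
Proof.
move=> b0.
pose S := [set (phi v - phi b) / (v - b) | v in [set v : R | b < v]].
have ubS u : 0 < u -> u < b -> ubound S ((phi b - phi u) / (b - u)).
  move=> u0 ub _ [v /= bv <-].
  have := concave_three_points u0 ub bv.
  rewrite ler_pdivrMr; last lra.
  by rewrite mulrAC ler_pdivlMr; [lra|lra].
have S0 : S !=set0.
  by exists ((phi (b + 1) - phi b) / (b + 1 - b)); exists (b + 1) => //=; lra.
have hS : has_sup S.
  by split => //; exists ((phi b - phi (b / 2)) / (b - b / 2)); apply: ubS; lra.
pose c := sup S.
have line v : 0 < v -> phi v <= phi b + c * (v - b).
  move=> v0; have [vb|bv|->] := ltgtP v b; last by rewrite subrr mulr0 addr0.
  - have : c <= (phi b - phi v) / (b - v) by apply: ge_sup => //; exact: ubS.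
    by rewrite ler_pdivlMr; lra.
  - have : (phi v - phi b) / (v - b) <= c by apply: ub_le_sup; [case: hS|exists v].
    by rewrite ler_pdivrMr; lra.
have pos v : 0 < v -> 0 < phi b + c * (v - b).
  by move=> v0; rewrite (lt_le_trans (phi_gt0 v0))// line.
exists c; split => //.
- rewrite leNgt; apply/negP => c0; have phib := phi_gt0 b0.
  have p : 0 < phi b / - c by rewrite divr_gt0//; lra.
  have := pos (b + phi b / - c) ltac:(lra).
  have -> : c * (b + phi b / - c - b) = - phi b by field; lra.
  by rewrite subrr ltxx.
- rewrite leNgt; apply/negP => cb; have phib := phi_gt0 b0.
  have c0 : 0 < c by rewrite -(pmulr_lgt0 _ b0); lra.
  have p : 0 < (c * b - phi b) / c by rewrite divr_gt0//; lra.
  have := pos ((c * b - phi b) / c) p.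
  have -> : c * ((c * b - phi b) / c - b) = - phi b by field; lra.
  by rewrite subrr ltxx.
Qed.

Lemma concave_nondecreasing (u v : R) : 0 < u -> u <= v -> phi u <= phi v.
Proof.
move=> u0 uv; have [c [c0 _ /(_ _ u0)]] := concave_support_line (lt_le_trans u0 uv).
move=> /le_trans; apply; rewrite gerDl mulr_ge0_le0//; lra.
Qed.

(** The map [v |-> phi v / v] is nonincreasing; this at most linear growth is what
makes the integral of [1 / phi] diverge at infinity. *)
Lemma concave_star_shaped (u v : R) : 0 < u -> u <= v -> phi v <= phi u / u * v.
Proof.
move=> u0 uv; have [c [c0 cu /(_ _ (lt_le_trans u0 uv))]] := concave_support_line u0.
move=> /le_trans; apply.
have : c * (v - u) <= phi u / u * (v - u).
  by rewrite ler_wpM2r ?ler_pdivlMr//; lra.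
have : phi u / u * u = phi u by rewrite divfK// gt_eqF.
lra.
Qed.

(** * The comparison function and its inverse *)

Section Hfun.
Variable w0 : R.
Hypothesis w0_gt0 : 0 < w0.
Let mu := @lebesgue_measure R.
Let H := Hfun w0 phi.

Lemma inv_phi_integrable w :
  mu.-integrable `[w0, w] (EFin \o (fun v => (phi v)^-1)).
Proof.
apply: (@le_integrable _ _ _ _ _ _ _ (EFin \o cst (phi w0)^-1)) => //.
- apply/measurable_EFinP.
  (* extended by a constant to the left of w0, 1 / phi is monotone on the line *)
  apply: (@eq_measurable_fun _ _ _ _ _ (fun v => (phi (Num.max w0 v))^-1)).
    move=> v; rewrite inE/= in_itv/= => /andP[w0v _].
    by rewrite (max_idPr w0v).
  apply: nonincreasing_measurable => // u v uv.
  have u0 : 0 < Num.max w0 u by rewrite lt_max w0_gt0.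
  have v0 : 0 < Num.max w0 v by rewrite lt_max w0_gt0.
  rewrite /= lef_pV2 ?posrE ?phi_gt0// concave_nondecreasing//.
  by rewrite ge_max !le_max lexx uv orbT.
- move=> v /=; rewrite in_itv/= => /andP[w0v _].
  have v0 := lt_le_trans w0_gt0 w0v.
  have pv := phi_gt0 v0; have pw := phi_gt0 w0_gt0.
  rewrite lee_fin /= !gtr0_norm ?invr_gt0// lef_pV2 ?posrE//.
  exact: concave_nondecreasing.
- apply: continuous_compact_integrable; first exact: segment_compact.
  by apply: continuous_subspaceT => x; exact: cvg_cst.
Qed.

Lemma Hfun_bounds (u v : R) : w0 <= u -> u <= v ->
  (v - u) / phi v <= H v - H u <= (v - u) / phi u.
Proof.
move=> w0u uv; have u0 := lt_le_trans w0_gt0 w0u.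
rewrite /H /Hfun Rintegral_itvB ?bnd_simp//; last exact: inv_phi_integrable.
have cstint (k : R) : \int[mu]_(x in `]u, v]) k = (v - u) * k.
  rewrite Rintegral_cst//= lebesgue_measure_itv/= lte_fin.
  case: ifP => [_|/negbT]; first by rewrite -EFinB/= mulrC.
  by rewrite -leNgt => vu; rewrite mulr0 (_ : v - u = 0) ?mul0r//; lra.
have sub : `]u, v]%classic `<=` `[w0, v]%classic.
  by move=> x /=; rewrite !in_itv/= => /andP[/ltW/(le_trans w0u)->].
have inti : mu.-integrable `]u, v] (EFin \o (fun v => (phi v)^-1)).
  exact: integrableS (inv_phi_integrable v).
have intc (k : R) : mu.-integrable `]u, v] (EFin \o cst k).
  have icc : mu.-integrable `[u, v] (EFin \o cst k).
    apply: continuous_compact_integrable; first exact: segment_compact.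
    by apply: continuous_subspaceT => x; exact: cvg_cst.
  by apply: integrableS icc => //; exact: subset_itv_oc_cc.
rewrite -2!cstint; apply/andP; split; apply: le_Rintegral => //;
    try exact: intc; move=> x/=; rewrite in_itv/= => /andP[ux xv];
  have x0 := lt_trans u0 ux; have v0 := lt_le_trans x0 xv.
- by rewrite lef_pV2 ?posrE ?phi_gt0// concave_nondecreasing.
- by rewrite lef_pV2 ?posrE ?phi_gt0// concave_nondecreasing// ltW.
Qed.

Lemma Hfun0 : H w0 = 0.
Proof. by rewrite /H /Hfun set_itv1 Rintegral_set1. Qed.

(** By [concave_star_shaped], doubling the argument adds at least a fixed amount
[k] to [H], so [H] is unbounded and the intermediate value theorem applies. *)
Lemma Hfun_surj (s : R) : 0 <= s -> exists2 w, w0 <= w & H w = s.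
Proof.
move=> s0.
pose k := w0 / (2 * phi w0).
have k0 : 0 < k by rewrite divr_gt0// mulr_gt0// phi_gt0.
have double (u : R) : w0 <= u -> H u + k <= H (2 * u).
  move=> w0u; have u0 := lt_le_trans w0_gt0 w0u.
  have u2 : u <= 2 * u by lra.
  have /andP[+ _] := Hfun_bounds w0u u2.
  have -> : 2 * u - u = u by ring.
  have : k <= u / phi (2 * u).
    have pw := phi_gt0 w0_gt0.
    have p2 : 0 < phi (2 * u) by apply: phi_gt0; lra.
    rewrite ler_pdivlMr//.
    apply: (le_trans (ler_wpM2l (ltW k0)
      (concave_star_shaped w0_gt0 (le_trans w0u u2)))).
    have -> // : k * (phi w0 / w0 * (2 * u)) = u.
    by rewrite /k; field; apply/andP; split; rewrite gt_eqF.
  lra.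
have pow n : w0 <= w0 * 2 ^+ n /\ n%:R * k <= H (w0 * 2 ^+ n).
  elim: n => [|n]; first by rewrite expr0 mulr1 mul0r Hfun0.
  rewrite exprS (mulrCA w0 2); move: (w0 * 2 ^+ n) => u [w0u IH].
  have u0 := lt_le_trans w0_gt0 w0u; have := double u w0u.
  split; first lra.
  by rewrite -natr1 mulrDl mul1r; apply: le_trans (double u w0u); rewrite lerD2r.
pose n := (Num.truncn (s / k)).+1.
have sn : s <= H (w0 * 2 ^+ n).
  apply: le_trans (pow n).2; rewrite -ler_pdivrMr//; apply: ltW.
  exact: truncnS_gt.
have w0n := (pow n).1.
have [|||w] := @IVT R H w0 (w0 * 2 ^+ n) s => //.
- apply: parameterized_integral_continuous => //; exact: inv_phi_integrable.
- by rewrite Hfun0 ge_min s0 le_max sn orbT.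
- by rewrite in_itv/= => /andP[w0w _] Hw; exists w.
Qed.

Lemma Hinv_ge (b s : R) : w0 <= b -> 0 <= s -> H b <= s -> b <= Hinv w0 phi s.
Proof.
move=> w0b s0 Hb.
have sP : s \in H @` `[w0, +oo[.
  rewrite inE; have [w w0w <-] := Hfun_surj s0; exists w => //=.
  by rewrite in_itv/= w0w.
have w0w : w0 <= Hinv w0 phi s.
  have : (`[w0, +oo[%classic : set R) (Hinv w0 phi s).
    rewrite /Hinv.
    have := @surjpinv_image_sub _ _ (fun=> w0) `[w0, +oo[ (H @` `[w0, +oo[) H.
    move=> /(_ (fun _ => id)); apply.
    by exists s => //; exact/set_mem.
  by rewrite /= in_itv/= andbT.
have HK : H (Hinv w0 phi s) = s by exact: pinvK.
rewrite leNgt; apply/negP => lt.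
have /andP[+ _] := Hfun_bounds w0w (ltW lt).
have b0 := lt_le_trans w0_gt0 w0b.
have : 0 < (b - Hinv w0 phi s) / phi b by rewrite divr_gt0 ?subr_gt0 ?phi_gt0.
by rewrite HK => p /(lt_le_trans p); rewrite subr_gt0 ltNge Hb.
Qed.

(** The explicit Euler scheme of step 1 for the equation [y' = phi y], whose exact
solution started at [w0] is [Hinv w0 phi]. *)
Fixpoint euler_scheme (n : nat) : R :=
  if n is m.+1 then euler_scheme m + phi (euler_scheme m) else w0.

Lemma euler_scheme_ge n : w0 <= euler_scheme n.
Proof.
elim: n => //= n IH; have := phi_gt0 (lt_le_trans w0_gt0 IH); lra.
Qed.

(** The exact solution is convex, so it stays above its Euler scheme: on the
interval swept by one step, of length [phi b], the integrand [1 / phi] is at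
most [1 / phi b]. *)
Lemma euler_scheme_le_Hinv n : euler_scheme n <= Hinv w0 phi n%:R.
Proof.
apply: Hinv_ge; rewrite ?euler_scheme_ge//.
elim: n => [|n IH]; first by rewrite Hfun0.
have p := phi_gt0 (lt_le_trans w0_gt0 (euler_scheme_ge n)).
have step : euler_scheme n <= euler_scheme n.+1 by rewrite /=; lra.
have /= /andP[_] := Hfun_bounds (euler_scheme_ge n) step.
rewrite (addrC (euler_scheme n)) addrK divff ?gt_eqF// -natr1; lra.
Qed.

End Hfun.
End concave.

(** * Optimisation over the level *)

(** The maximiser of the right-hand side over [r > 0] is
[r = (alpha A / (kappa C))^(1 / (alpha - kappa))]; at this point the second term
is [kappa / alpha] times the first. *)
Lemma tail_difference_max {R : realType} (C kappa alpha A : R) :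
  0 < C <= 1 -> 0 < kappa -> kappa < alpha -> 1 <= A ->
  exists2 r, 1 <= r &
  C `^ (alpha / (alpha - kappa)) *
    ((kappa / alpha) `^ (kappa / (alpha - kappa)) -
     (kappa / alpha) `^ (alpha / (alpha - kappa))) *
    A `^ (- (kappa / (alpha - kappa)))
  = C * r `^ (- kappa) - A * r `^ (- alpha).
Proof.
move=> /andP[C0 C1] k0 ka A1.
have s0 : 0 < alpha - kappa by lra.
pose q := kappa / alpha.
have q0 : 0 < q by rewrite divr_gt0//; lra.
have q1 : q < 1 by rewrite ltr_pdivrMr; lra.
pose e := kappa / (alpha - kappa).
have ae : alpha / (alpha - kappa) = 1 + e by rewrite /e; field; lra.
have A0 : 0 < A by lra.
pose B := A / (q * C).
have qC : 0 < q * C by rewrite mulr_gt0.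
have qC1 : q * C <= 1 by rewrite mulr_ile1//; lra.
have B0 : 0 < B by rewrite divr_gt0.
have B1 : 1 <= B by rewrite ler_pdivlMr//; lra.
exists (B `^ (alpha - kappa)^-1).
  have sinv : 0 <= (alpha - kappa)^-1 by rewrite invr_ge0 ltW.
  by rewrite -[leLHS](powRr0 B) ler_powR.
have PM (x y : R) : 0 < x -> x `^ (1 + y) = x * x `^ y.
  move=> x0; rewrite powRD ?powRr1 ?ltW//.
  by rewrite (gt_eqF x0) implybT.
have k1 : (alpha - kappa)^-1 * - kappa = - e by rewrite /e mulrN mulrC.
have a1 : (alpha - kappa)^-1 * - alpha = - (1 + e) by rewrite -ae mulrN mulrC.
rewrite -!powRrM k1 a1 ae -/e -/q !PM// powRN (powRN B (1 + e)) PM//.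
rewrite powRN.
have invE : (q * C)^-1 `^ e = (q `^ e * C `^ e)^-1.
  by rewrite -powR_inv1 ?ltW// -powRrM mulN1r powRN powRM ?ltW.
have Be : B `^ e = A `^ e / (q `^ e * C `^ e).
  by rewrite /B powRM ?ltW ?invr_gt0// invE.
have qe := powR_gt0 e q0; have Ce := powR_gt0 e C0; have Ae := powR_gt0 e A0.
rewrite Be /B; field.
by rewrite !gt_eqF.
Qed.

(** * Moments of the adaptive process *)

Section kernels.
Context {d0 d1 d2} {T0 : measurableType d0} {T1 : measurableType d1}
  {T2 : measurableType d2} {R : realType}.
Local Open Scope ereal_scope.

Lemma integral_pkcomp_param (k1 : R.-pker T0 ~> T1) (k2 : R.-pker (T0 * T1) ~> T2)
    x (f : T2 -> \bar R) : (forall z, 0 <= f z) -> measurable_fun setT f ->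
  \int[pkcomp_param k1 k2 x]_z f z = \int[k1 x]_y \int[k2 (x, y)]_z f z.
Proof. exact: integral_kcomp. Qed.

(** The composition agrees with the one along a kernel that ignores its first
argument, for which the integration formula is known. *)
Lemma integral_pkcomp (k1 : R.-pker T0 ~> T1) (k2 : R.-pker T1 ~> T2)
    x (f : T2 -> \bar R) : (forall z, 0 <= f z) -> measurable_fun setT f ->
  \int[pkcomp k1 k2 x]_z f z = \int[k1 x]_y \int[k2 y]_z f z.
Proof.
move=> f0 mf.
rewrite -(integral_pkcomp_param k1
  (kprecomp k2 (@measurable_snd _ _ T0 T1)) x f0 mf).
exact: eq_measure_integral.
Qed.

Lemma integral_kdirac (g : T0 -> T1) (mg : measurable_fun setT g) x
    (f : T1 -> \bar R) : measurable_fun setT f ->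
  \int[kdirac mg x : {measure set T1 -> \bar R}]_z f z = f (g x).
Proof. by move=> mf; rewrite integral_dirac// diracT mul1e. Qed.

End kernels.

Section moments.
Context {R : realType} {dX dY : measure_display}
  {X : measurableType dX} {Y : measurableType dY}.
Variables (P : R.-pker (X * Y) ~> X) (Q : adaptation_plan R X Y).
Local Open Scope ereal_scope.

Lemma current_state_extend t (h : t.+1.-tuple (Y * X)) g x :
  current_state (extend (h, g, x)) = x.
Proof.
rewrite /current_state /extend (tnth_nth (g, x))/=.
by rewrite nth_rcons size_tuple ltnn eqxx.
Qed.

Lemma integral_state_law t z (f : X -> \bar R) :
  (forall x, 0 <= f x) -> measurable_fun setT f ->
  \int[state_law P Q t z]_x f x =
  \int[history_law P Q t z]_h f (current_state h).
Proof.
move=> f0 mf; rewrite integral_pkcomp//.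
by apply: eq_integral => h _; rewrite integral_kdirac.
Qed.

Lemma integral_state_lawS t z (f : X -> \bar R) :
  (forall x, 0 <= f x) -> measurable_fun setT f ->
  \int[state_law P Q t.+1 z]_x f x =
  \int[history_law P Q t z]_h \int[Q t h]_g \int[P (current_state h, g)]_x f x.
Proof.
move=> f0 mf; rewrite integral_state_law//=.
have fc0 (h : t.+2.-tuple (Y * X)) : 0 <= f (current_state h) by exact: f0.
have mfc : measurable_fun setT (fun h : t.+2.-tuple (Y * X) => f (current_state h)).
  exact: measurableT_comp (@measurable_current_state _ _ _ _ _).
rewrite (integral_pkcomp _ _ _ fc0 mfc).
apply: eq_integral => h _; rewrite (integral_pkcomp_param _ _ _ fc0 mfc).
apply: eq_integral => g _; rewrite (integral_pkcomp_param _ _ _ fc0 mfc).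
apply: eq_integral => x _.
by rewrite (integral_kdirac _ _ mfc) current_state_extend.
Qed.

(** With [b] the value of the scheme at time [t] and [c] the slope of a support
line of [phi] at [b], the drift gives
[P V <= V + phi V <= (phi b - c * b) + (1 + c) * V] pointwise. Both coefficients
are nonnegative, so integrating this bound only involves nonnegative functions,
and the finiteness of the moments is a conclusion rather than a hypothesis. *)
Lemma state_law_drift (V : X -> R) (phi : R -> R) (z : Y * X) (t : nat) :
  measurable_fun setT V -> (forall x, 0 < V x)%R ->
  (forall v, 0 < v -> 0 < phi v)%R -> (concave_function `]0, +oo[ phi)%R ->
  (forall x g, \int[P (x, g)]_y (V y)%:E - (V x)%:E <= (phi (V x))%:E) ->
  \int[state_law P Q t z]_x (V x)%:E <= (euler_scheme phi (V z.2) t)%:E.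
Proof.
move=> mV V0 phi0 phic drift.
have mVE : measurable_fun setT (EFin \o V) by exact/measurable_EFinP.
have VE0 x : 0 <= (V x)%:E by rewrite lee_fin ltW.
have mVc n : measurable_fun setT
    (fun h : n.+1.-tuple (Y * X) => (V (current_state h))%:E).
  exact: measurableT_comp mVE (@measurable_current_state _ _ _ _ _).
elim: t => [|t IH].
  by rewrite integral_state_law// (integral_kdirac _ _ (mVc 0%N)).
set b := euler_scheme phi (V z.2) t in IH *.
have b0 : (0 < b)%R by apply: lt_le_trans (V0 z.2) _; exact: euler_scheme_ge.
have [c [c0 cb line]] := concave_support_line phi0 phic b0.
rewrite integral_state_lawS//.
have mPV : measurable_fun setT (fun u => \int[P u]_x (V x)%:E).
  exact: measurable_fun_integral_kernel (measurable_kernel P) _ VE0 mVE.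
apply: (@le_trans _ _ (\int[history_law P Q t z]_h
   ((phi b - c * b)%:E + (1 + c)%:E * (V (current_state h))%:E))).
  apply: ge0_le_integral => //=.
  - move=> h _; apply: integral_ge0 => g _; exact: integral_ge0.
  - apply: (measurable_fun_integral_sfinite_kernel
      (fun u => \int[P (current_state u.1, u.2)]_x (V x)%:E)) => [u|].
      exact: integral_ge0.
    exact: measurableT_comp mPV (@measurable_state_parameter _ _ _ _ _).
  - by apply: emeasurable_funD => //; apply: measurable_funeM; exact: mVc.
  - move=> h _.
    have stp g : \int[P (current_state h, g)]_x (V x)%:E <=
       (phi b - c * b + (1 + c) * V (current_state h))%:E.
      have := drift (current_state h) g.
      rewrite leeBlDr// => /le_trans; apply.
      rewrite -EFinD lee_fin.
      have := line _ (V0 (current_state h)); lra.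
    apply: (@le_trans _ _ (\int[Q t h]_g
        (phi b - c * b + (1 + c) * V (current_state h))%:E)).
      apply: ge0_le_integral => //.
      + move=> g _; exact: integral_ge0.
      + exact: measurable_fun_pair2 mPV.
    by rewrite integral_cst// prob_kernel mule1 EFinD EFinM.
rewrite ge0_integralD//=; last 3 first.
  - by move=> _ _; rewrite lee_fin; lra.
  - by move=> h _; rewrite -EFinM lee_fin mulr_ge0//; [lra|exact: ltW].
  - by apply: measurable_funeM; exact: mVc.
rewrite integral_cst// prob_kernel mule1 ge0_integralZl//=; last 2 first.
  - exact: mVc.
  - by rewrite lee_fin; lra.
move: IH; rewrite integral_state_law// => IH.
apply: (@le_trans _ _ ((phi b - c * b)%:E + (1 + c)%:E * b%:E)).
  by rewrite leeD2l// lee_wpmul2l// lee_fin; lra.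
by rewrite -EFinM -EFinD lee_fin/= -/b; lra.
Qed.
End moments.

(** * Couplings and tails *)

(** The product of the Borel sigma-algebras need not contain every open set of the
product without separability. Here the open set is a countable union of
rectangles: if [d(x, y) > delta], some point [p] of a countable dense set is so
close to [x] that [d(p, y)] still exceeds [delta] by more than [d(p, x)]. *)
Lemma measurable_mdist_gt {R : realType} (X : polishMetricType R) (delta : R) :
  measurable [set z : borel X * borel X | delta < mdist (z.1 : X) (z.2 : X)].
Proof.
have [D cD dD] := @separable_space R X.
pose far (p : X) (n : nat) : set (borel X * borel X) :=
  [set x : X | mdist p x < n.+1%:R^-1] `*`
  [set y : X | delta + n.+1%:R^-1 < mdist p y].
have witness (x y : X) : delta < mdist x y ->
    exists2 p, D p & exists n : nat,
      mdist p x < n.+1%:R^-1 /\ delta + n.+1%:R^-1 < mdist p y.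
  move=> xy; have d0 : 0 < mdist x y - delta by lra.
  pose n := Num.truncn (2 / (mdist x y - delta)).
  have nd : 2 * n.+1%:R^-1 < mdist x y - delta.
    by rewrite ltr_pdivrMr// mulrC -ltr_pdivrMr// truncnS_gt.
  have n0 : (0 : R) < n.+1%:R^-1 by rewrite invr_gt0.
  have [p [xp Dp]] : (ball x n.+1%:R^-1)° `&` D !=set0.
    apply: dD; last exact: open_interior.
    by exists x; exact: nbhsx_ballx n0.
  exists p => //; exists n.
  have {}xp : mdist p x < n.+1%:R^-1.
    by have := interior_subset xp; rewrite ballEmdist/= metric_sym.
  split; first exact: xp.
  have arith (e a b c : R) :
    2 * e < a - delta -> b < e -> a <= b + c -> delta + e < c by lra.
  have tri : mdist x y <= mdist p x + mdist p y.
    by rewrite (metric_sym p x) metric_triangle.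
  exact: (arith _ _ _ _ nd xp tri).
have -> : [set z : borel X * borel X | delta < mdist (z.1 : X) (z.2 : X)] =
    \bigcup_(p in D) \bigcup_n far p n.
  apply/seteqP; split => [[x y] /witness[p Dp [n pn]]|
                          [x y] [p Dp [n _ [/= px py]]]].
    by exists p => //; exists n.
  rewrite -(ltrD2r n.+1%:R^-1) (lt_le_trans py)//.
  by rewrite (le_trans (metric_triangle p x y))// addrC lerD2l ltW.
have mball (p : X) r : open [set x : X | mdist p x < r].
  rewrite openE => x /= px; apply/nbhs_ballP; exists (r - mdist p x).
    by rewrite /= subr_gt0.
  move=> y; rewrite ballEmdist/= => xy.
  by rewrite (le_lt_trans (metric_triangle p x y))// -ltrBrDl.
have mcball (p : X) r : open [set x : X | r < mdist p x].
  rewrite openE => x /= px; apply/nbhs_ballP; exists (mdist p x - r).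
    by rewrite /= subr_gt0.
  move=> y; rewrite ballEmdist/= ltrBrDr -ltrBrDl => xy.
  by rewrite (lt_le_trans xy)// lerBlDr (metric_sym x y) metric_triangle.
rewrite bigcup_set_type; apply: countable_bigcupT_measurable => [|p].
  by rewrite (eq_countable (card_setT _)).
apply: bigcupT_measurable => n.
by apply: measurableX; apply: sub_sigma_algebra.
Qed.

Lemma coupling_tail_le {R : realType} {X : polishMetricType R}
    (mu nu : {measure set (borel X) -> \bar R}) (W : borel X -> R)
    (L delta : R) xi (r : R) :
  measurable_fun setT W -> (forall x, 0 < W x) -> 0 <= L ->
  (forall x y : X, `|ln (W x) - ln (W y)| <= L * mdist x y) ->
  coupling mu nu xi ->
  (nu [set y | (r <= W y)%R] <=
   xi [set z : borel X * borel X | (delta < mdist (z.1 : X) (z.2 : X))%R] +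
   mu [set x | (r * expR (- (L * delta)) <= W x)%R])%E.
Proof.
move=> mW W0 L0 lip [xi1 xi2].
have mge s : measurable [set x | s <= W x].
  rewrite (_ : [set x | _] = W @^-1` `[s, +oo[); last first.
    by apply/seteqP; split => x /=; rewrite in_itv/= andbT.
  by rewrite -[X in measurable X]setTI; exact: mW.
rewrite -xi2// -xi1//.
apply: le_trans (measureU2 _ _ _); last 2 first.
- exact: measurable_mdist_gt.
- exact: measurableX.
apply: le_measure; rewrite ?inE.
- exact: measurableX.
- by apply: measurableU; [exact: measurable_mdist_gt|exact: measurableX].
- move=> [x y] [_ /= ry].
  have [dxy|dxy] := ltP delta (mdist (x : X) y); [by left|right; split => //=].
  have Wx0 := W0 x; have Wy0 := W0 y.
  rewrite expRN ler_pdivrMr ?expR_gt0// (le_trans ry)//.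
  rewrite -ler_ln ?posrE ?mulr_gt0 ?expR_gt0// lnM ?posrE ?expR_gt0// expRK.
  have := lip x y; rewrite ler_norml => /andP[+ _].
  have : L * mdist (x : X) y <= L * delta by rewrite ler_wpM2l.
  lra.
Qed.

Lemma markov_powR {R : realType} d (T : measurableType d)
   (mu : {measure set T -> \bar R}) (W : T -> R) (alpha s : R) :
  measurable_fun setT W -> (forall x, 0 <= W x) -> 0 < s -> 0 < alpha ->
  (mu [set x | (s <= W x)%R] <= (s `^ (- alpha))%:E * \int[mu]_x (W x `^ alpha)%:E)%E.
Proof.
move=> mW W0 s0 a0.
have mWa : measurable_fun setT (fun x => (W x `^ alpha)%:E).
  by apply/measurable_EFinP; exact: measurableT_comp (measurable_powR alpha) mW.
have sa : 0 < s `^ alpha by rewrite powR_gt0.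
have levelE : [set x | s <= W x] =
    [set x | ((s `^ alpha)%:E <= `|(W x `^ alpha)%:E|)%E].
  apply/seteqP; split => x /=; rewrite lee_fin ger0_norm ?powR_ge0//.
    by move=> sW; rewrite ge0_ler_powR ?nnegrE// ltW.
  rewrite leNgt => /negP WS; rewrite leNgt; apply/negP => Ws; apply: WS.
  by rewrite gt0_ltr_powR ?nnegrE// ltW.
have absE x : `|(W x `^ alpha)%:E|%E = (W x `^ alpha)%:E.
  by rewrite gee0_abs// lee_fin powR_ge0.
have := le_integral_abse mu measurableT mWa sa.
rewrite setTI -levelE (eq_integral (fun x => (W x `^ alpha)%:E))//.
by rewrite powRN lee_pdivlMl.
Qed.

(** * The lower bound *)

Theorem theorem4 (R : realType) (X : polishMetricType R)
    (dY : measure_display) (Y : measurableType dY)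
    (pi : probability (borel X) R)
    (P : R.-pker (borel X * Y)%type ~> borel X)
    (gamma0 : Y) (x0 : borel X)
    (W : borel X -> R) (C kappa alpha : R) (phi : R -> R)
    (W_measurable : measurable_fun [set: borel X] W)
    (W_ge1 : forall x, 1 <= W x)
    (C_bounds : 0 < C <= 1)
    (kappa_gt0 : 0 < kappa)
    (pi_tail : forall r : R, 1 <= r ->
      ((C * r `^ (- kappa))%:E <= pi [set x | (r <= W x)%R])%E)
    (alpha_gt_kappa : kappa < alpha)
    (phi_gt0 : forall v, 0 < v -> 0 < phi v)
    (phi_concave : concave_function `]0, +oo[ phi)
    (drift : forall (x : borel X) (gamma : Y),
      ((\int[P (x, gamma)]_y (W y `^ alpha)%:E) - (W x `^ alpha)%:E
        <= (phi (W x `^ alpha))%:E)%E)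
    (logW_lipschitz : lipschitz_fun (fun x : X => ln (W x))) :
  let M := C `^ (alpha / (alpha - kappa)) *
    ((kappa / alpha) `^ (kappa / (alpha - kappa)) -
     (kappa / alpha) `^ (alpha / (alpha - kappa))) in
  forall eps : R, 0 < eps < 1 ->
  exists2 delta : R, 0 < delta < 1 &
  forall t : nat, (0 < t)%N ->
    (((1 - eps) * M /
      (Hinv (W x0 `^ alpha) phi t%:R) `^ (kappa / (alpha - kappa)))%:E
     <= ereal_inf [set
          ereal_inf [set xi [set z : borel X * borel X |
                             (delta < mdist (z.1 : X) (z.2 : X))%R]
                    | xi in coupling (state_law P Q t (gamma0, x0)) pi]
        | Q in [set: adaptation_plan R (borel X) Y]])%E.
Proof.
move=> M eps /andP[eps0 eps1].
have [L0 lip0] := logW_lipschitz.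
(* a Lipschitz constant may be negative when the space is a single point *)
pose L := Num.max L0 0.
have L_ge0 : 0 <= L by rewrite le_max lexx orbT.
have lip (x y : X) : `|ln (W x) - ln (W y)| <= L * mdist x y.
  by rewrite (le_trans (lip0 x y))// ler_wpM2r ?mdist_ge0// le_max lexx.
have alpha0 : 0 < alpha by lra.
pose e := kappa / (alpha - kappa).
have e0 : 0 < e by rewrite divr_gt0//; lra.
(* K delta is the loss in the exponent: exp(- K delta) >= 1 - K delta >= 1 - eps *)
pose K := alpha * L * e.
have K0 : 0 <= K by apply: mulr_ge0; [apply: mulr_ge0|]; rewrite ?L_ge0// ltW.
pose delta := eps / (1 + K).
have delta0 : 0 < delta by rewrite divr_gt0//; lra.
have delta1 : delta < 1 by rewrite ltr_pdivrMr; lra.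
have Kdelta : K * delta <= eps.
  by rewrite /delta mulrA ler_pdivrMr; [rewrite mulrC ler_wpM2l; lra|lra].
exists delta; first by rewrite delta0.
move=> t _.
have W0 x : 0 < W x := lt_le_trans ltr01 (W_ge1 x).
have mWa : measurable_fun setT (fun x => W x `^ alpha).
  exact: measurableT_comp (measurable_powR alpha) W_measurable.
have Wa0 x : 0 < W x `^ alpha by rewrite powR_gt0.
have Wa1 : 1 <= W x0 `^ alpha.
  by rewrite -[leLHS](powRr0 (W x0)) ler_powR// ltW.
set h := Hinv _ phi t%:R.
have h1 : 1 <= h.
  apply: le_trans (euler_scheme_le_Hinv phi_gt0 phi_concave (Wa0 x0) t).
  by apply: le_trans Wa1 _; exact: euler_scheme_ge.
have h0 : 0 < h by rewrite (lt_le_trans ltr01).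
apply: le_ereal_inf_tmp => _ [Q _ <-]; apply: le_ereal_inf_tmp => _ [xi xiC <-].
pose A := h * expR (alpha * (L * delta)).
have A1 : 1 <= A.
  rewrite -[1]mulr1 ler_pM//.
  rewrite -expR0 ler_expR mulr_ge0 ?(ltW alpha0)//.
  by rewrite mulr_ge0// ltW.
have [r r1 Mr] := tail_difference_max C_bounds kappa_gt0 alpha_gt_kappa A1.
have r0 : 0 < r by rewrite (lt_le_trans ltr01).
have M0 : 0 <= M.
  have [C0 _] := andP C_bounds.
  rewrite mulr_ge0 ?powR_ge0// subr_ge0.
  have q0 : 0 < kappa / alpha by rewrite divr_gt0.
  have q1 : kappa / alpha <= 1 by rewrite ler_pdivrMr ?mul1r// ltW.
  by rewrite ger_powR ?q0//= ler_wpM2r ?invr_ge0 ?subr_ge0// ltW.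
have moment : (\int[state_law P Q t (gamma0, x0)]_x (W x `^ alpha)%:E <= h%:E)%E.
  have := state_law_drift Q (gamma0, x0) t mWa Wa0 phi_gt0 phi_concave drift.
  move=> /le_trans; apply.
  by rewrite lee_fin euler_scheme_le_Hinv.
have tail : ((C * r `^ (- kappa))%:E <=
    xi [set z : borel X * borel X | (delta < mdist (z.1 : X) (z.2 : X))%R] +
    (A * r `^ (- alpha))%:E)%E.
  apply: (le_trans (pi_tail _ r1)).
  apply: (le_trans (coupling_tail_le delta r W_measurable W0 L_ge0 lip xiC)).
  rewrite leeD2l//.
  set s := r * expR _.
  have s0 : 0 < s by rewrite mulr_gt0 ?expR_gt0.
  apply: (le_trans (markov_powR _ W_measurable (fun x => ltW (W0 x)) s0 alpha0)).
  apply: (@le_trans _ _ ((s `^ (- alpha))%:E * h%:E)%E).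
    by rewrite lee_wpmul2l// lee_fin powR_ge0.
  rewrite -EFinM lee_fin /s /A powRM ?expR_ge0 ?(ltW r0)//.
  rewrite -[expR _ `^ _]expRM mulNr mulrN opprK.
  (* A was chosen for both sides to be equal *)
  rewrite le_eqVlt; apply/orP; left; apply/eqP.
  by rewrite (mulrC alpha); ring.
rewrite -leeBlDr// in tail.
apply: le_trans tail; rewrite -EFinB lee_fin -Mr -/M.
rewrite (mulrC (1 - eps)) -mulrA ler_wpM2l// -/e.
rewrite /A powRM ?expR_ge0 ?(ltW h0)// powRN mulrC ler_wpM2l ?invr_ge0 ?powR_ge0//.
rewrite -[expR _ `^ _]expRM.
apply: le_trans (expR_ge1Dx _).
move: Kdelta; rewrite /K; lra.
Qed.
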